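(* Let $R$ be a Henselian valued ring with maximal ideal $\mathfrak{m}$, equipped with the valuation topology. Let $n\ge 1$, let $f=(f_1,\ldots,f_n)$ be an $n$-tuple of polynomials $f_1,\ldots,f_n\in R[X]$, $X=(X_1,\ldots,X_n)$, and let $J$ be its Jacobian determinant. If $f(\mathbf{0})=\mathbf{0}$ and $e:=J(\mathbf{0})\neq 0$, then $f$ is an open embedding of $e^{2}\cdot\mathfrak{m}^{\times n}$ into $e\cdot\mathfrak{m}^{\times n}$.
   Context: $\mathfrak{m}^{\times n}$ is the $n$-fold Cartesian product of $\mathfrak{m}$; for $c\in R$, $c\cdot\mathfrak{m}^{\times n}=\{c x: x\in\mathfrak{m}^{\times n}\}$. $\mathbf{0}=(0,\ldots,0)\in R^n$, and $J=\det\left[\partial f_i/\partial X_j\right]_{i,j=1}^n$. A Henselian valued ring is a valuation ring (of a valuation of arbitrary rank on its fraction field) that is a Henselian local ring; the valuation topology is the topology induced by this valuation, and $R^n$ and its subsets carry the product and subspace topologies. An open embedding is a homeomorphism onto an open subset of the target. *)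

(* Defs.v *)
From HB Require Import structures.
From mathcomp Require Import all_boot all_order all_algebra.
From mathcomp Require Import boolp classical_sets functions topology.
From mathcomp.multinomials Require Import mpoly.

(* MathComp world; from MathComp-Analysis only general topology is used. *)

Set Implicit Arguments.
Unset Strict Implicit.
Unset Printing Implicit Defensive.

Import Order.TTheory GRing.Theory Num.Theory.

Local Open Scope classical_set_scope.
Local Open Scope ring_scope.

(* Totally ordered abelian groups, of arbitrary rank. *)
Record ordAbGroupType := OrdAbGroupType {
  ordab_sort :> porderZmodType;
  ordab_leD2l : forall z x y : ordab_sort, x <= y -> z + x <= z + y;
  ordab_total : forall x y : ordab_sort, (x <= y) || (y <= x)
}.

(* Krull valuations, written additively, with value group exactly [G].  Only
   the values at nonzero elements are meaningful: the convention v 0 = +oo is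
   built into the statements below, and [v 0 : G] is never used. *)
Record krullValuation (K : fieldType) (G : ordAbGroupType) := KrullValuation {
  kval :> K -> G;
  kvalM : forall x y, x != 0 -> y != 0 -> kval (x * y) = kval x + kval y;
  kvalD : forall x y, x != 0 -> y != 0 -> x + y != 0 ->
    Order.min (kval x) (kval y) <= kval (x + y);
  kval_surj : forall g : G, exists2 x, x != 0 & kval x = g
}.

Section ValuedRing.
Variables (R : idomainType) (G : ordAbGroupType).
Variable v : krullValuation {fraction R} G.

Definition is_valuation_ring :=
  forall x : {fraction R},
    (exists r : R, x = tofrac r) <-> (x = 0 \/ 0 <= v x).

(* The open ball {y | v (y - x) > g}; the disjunct y = x is v 0 = +oo. *)
Definition vball (x : R) (g : G) : set R :=
  [set y | y = x \/ g < v (tofrac (y - x))].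

Definition vopen (U : set R) := forall x, U x -> exists g, vball x g `<=` U.

Lemma vopenT : vopen setT.
Proof. by move=> x _; exists 0. Qed.

Lemma vopenI : setI_closed vopen.
Proof.
move=> U V oU oV x [Ux Vx].
have [g gU] := oU x Ux; have [h hV] := oV x Vx.
exists (Order.max g h) => y [->|]; first by [].
rewrite comparable_gt_max; last exact: ordab_total.
by move=> /andP[gy hy]; split; [apply: gU|apply: hV]; right.
Qed.

Lemma vopen_bigU (I : Type) (U : I -> set R) :
  (forall i, vopen (U i)) -> vopen (\bigcup_i U i).
Proof.
move=> oU x [i _ Uix]; have [g gU] := oU i x Uix.
by exists g => y /gU Uiy; exists i.
Qed.

(* A copy of the ring [R], endowed with the valuation topology of [v]. *)
Definition valued_ring (_ : krullValuation {fraction R} G) : Type := R.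

HB.instance Definition _ := GRing.IntegralDomain.on (valued_ring v).
HB.instance Definition _ :=
  isOpenTopological.Build (valued_ring v) vopenT vopenI vopen_bigU.

End ValuedRing.

(* The maximal ideal of a local ring is the set of its nonunits. *)
Definition max_ideal (R : comUnitRingType) : set R :=
  [set x | x \isn't a GRing.unit].

Definition is_local_ring (R : comUnitRingType) :=
  forall x y : R, max_ideal x -> max_ideal y -> max_ideal (x + y).

(* Simple roots of monic polynomials over the residue field lift; [a] is a
   representative in [R] of the residue root. *)
Definition is_henselian (R : comUnitRingType) :=
  is_local_ring R /\
  forall (P : {poly R}) (a : R), P \is monic ->
    max_ideal P.[a] -> ~ max_ideal (P^`()).[a] ->
    exists2 b, root P b & max_ideal (b - a).

Section PolyMap.
Variables (R : comUnitRingType) (n : nat).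
Implicit Types (f : 'I_n -> {mpoly R[n]}) (x : 'rV[R]_n).

Definition polymap f x : 'rV[R]_n := \row_i (f i).@[fun j => x 0 j].

Definition jacobian f : {mpoly R[n]} := \det (\matrix_(i, j) (f i)^`M(j)).

Definition scaled_max_ideal_power (c : R) : set 'rV[R]_n :=
  [set c *: x | x in [set x : 'rV[R]_n | forall i, max_ideal (x 0 i)]].

End PolyMap.

(* [f] restricts to a homeomorphism, with inverse [g], from the subspace [A]
   onto a subset of [B] that is open in the subspace [B]. *)
Definition open_embedding (X Y : topologicalType) (A : set X) (B : set Y)
    (f : X -> Y) :=
  [/\ f @` A `<=` B,
      exists2 U, open U & f @` A = U `&` B,
      {within A, continuous f} &
      exists g : Y -> X,
        {in A, cancel f g} /\ {within f @` A, continuous g}].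

(* Main.v *)
Require Import Defs.
From HB Require Import structures.
From mathcomp Require Import all_boot all_order all_algebra.
From mathcomp Require Import boolp classical_sets functions topology.
From mathcomp.multinomials Require Import mpoly.
From mathcomp Require Import ring.
Import Order.TTheory GRing.Theory Num.Theory.
Local Open Scope classical_set_scope.
Local Open Scope ring_scope.
Set Implicit Arguments.
Unset Strict Implicit.
Unset Printing Implicit Defensive.

(** A valuation is used below only through divisibility: in a valuation ring
    any two elements are comparable for divisibility, and v a <= v b means that
    a divides b.

    Rescaling.  Let M be the Jacobian matrix of f at 0, so that det M = e and
    M * adj M = e.  Writing f (e^2 x) = e^2 M x + e^4 Q x with Q vanishing to
    order two at 0, one gets f (e^2 x) = e^2 M (F x) for the polynomial map
    F x = x + e adj M (Q x), whose Jacobian matrix at 0 is the identity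
    ([normal_form]).  If F permutes m^n and preserves the valuation of
    differences, then the image of e^2 m^n is the subgroup e^2 M m^n of R^n; it
    is contained in e m^n and contains e^2 M (adj M) m^n = e^3 m^n, so it is
    open, and a difference of values divisible by e c comes from a difference
    of arguments divisible by c ([scaled_image_open],
    [scaled_inverse_lipschitz]).

    That F preserves the valuation of differences is a first order Taylor
    expansion ([f_expanding]).  Surjectivity of F is the several variable
    Hensel lemma [multi_hensel], which has to be deduced from the one variable
    Henselian property for a value group of arbitrary rank.  There f stands for
    any n polynomials with f 0 in m^n and J(0) a unit.  Suppose that f has no
    zero in m^n, and call c reached if c divides f x for some x in m^n.  A
    Newton step shows that with c also c^2 is reached; as c d divides c^2 or
    d^2, the reached elements are closed under products.  The values P x at points where f x is
    divisible by more and more reached elements converge, and the polynomials P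
    for which they converge to 0 form a prime ideal I ([limit_ideal_prime])
    which contains every f_j and does not contain the Jacobian determinant.
    By the Jacobian criterion ([separable_relation]) each coordinate X_i
    satisfies modulo I a separable relation: P_i(X_i) lies in I and P_i'(X_i)
    does not.  Hence P_i'(x_i) has bounded valuation whereas P_i(x_i) becomes
    divisible by every reached element, so the one variable lemma produces
    roots xi_i of P_i as close to x_i as wanted, and they do not depend on x
    because a simple root is isolated.  The point xi then makes f xi divisible
    by every reached element.  But the entry g of f xi of least valuation is
    itself reached, thus g^2 is reached and divides g, so g is a unit; this
    contradicts xi in m^n ([no_zero_absurd]). *)

(** * Divisibility and the maximal ideal *)

Definition divides (R : comPzRingType) (c a : R) := exists b, a = c * b.

Section Divides.
Variable R : comPzRingType.
Implicit Types a b c d : R.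

Lemma divides_refl a : divides a a. Proof. by exists 1; rewrite mulr1. Qed.
Lemma divides0 a : divides a 0. Proof. by exists 0; rewrite mulr0. Qed.
Lemma dividesD c a b : divides c a -> divides c b -> divides c (a + b).
Proof. by move=> [x ->] [y ->]; exists (x + y); rewrite mulrDr. Qed.
Lemma divides_mull c a b : divides c a -> divides c (b * a).
Proof. by move=> [x ->]; exists (b * x); rewrite mulrCA. Qed.
Lemma divides_mulr c a b : divides c a -> divides c (a * b).
Proof. by rewrite mulrC; apply: divides_mull. Qed.
Lemma dividesB c a b : divides c a -> divides c b -> divides c (a - b).
Proof. by move=> ca cb; apply: dividesD => //; rewrite -mulN1r; apply: divides_mull. Qed.
Lemma divides_trans a b c : divides a b -> divides b c -> divides a c.
Proof. by move=> ab [y ->]; apply: divides_mulr. Qed.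
Lemma dividesM a b c d : divides a b -> divides c d -> divides (a * c) (b * d).
Proof. by move=> [x ->] [y ->]; exists (x * y); rewrite mulrACA. Qed.
End Divides.

Section MaxIdeal.
Variable R : comUnitRingType.
Implicit Types a b c x : R.

Lemma max_ideal0 : max_ideal (0 : R).
Proof. by rewrite /max_ideal /= unitr0. Qed.
Lemma max_ideal_mull a x : max_ideal x -> max_ideal (a * x).
Proof. by rewrite /max_ideal /= unitrM negb_and => ->; rewrite orbT. Qed.
Lemma max_idealN x : max_ideal (- x) <-> max_ideal x.
Proof. by rewrite /max_ideal /= unitrN. Qed.
Lemma max_ideal_divides a x : divides a x -> max_ideal a -> max_ideal x.
Proof. by move=> [y ->] ma; rewrite mulrC; apply: max_ideal_mull. Qed.
Lemma max_idealPn x : ~ max_ideal x <-> x \is a GRing.unit.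
Proof. by rewrite /max_ideal /=; split=> [/negP/negPn|->]. Qed.

Hypothesis R_local : is_local_ring R.

Lemma max_idealB x y : max_ideal x -> max_ideal y -> max_ideal (x - y).
Proof. by move=> mx my; apply: R_local => //; apply/max_idealN. Qed.
Lemma max_ideal_unitD u x : u \is a GRing.unit -> max_ideal x ->
  u + x \is a GRing.unit.
Proof.
move=> uu mx; apply/max_idealPn => mux.
by have := max_idealB mux mx; rewrite addrK; move/max_idealPn: uu.
Qed.
Lemma max_ideal_sum (I : finType) (F : I -> R) :
  (forall i, max_ideal (F i)) -> max_ideal (\sum_i F i).
Proof. by move=> mF; elim/big_ind: _ => //; exact: max_ideal0. Qed.
End MaxIdeal.

(** * Hensel's lemma in one variable *)

Section Hensel1.
Lemma pred_subK i s : (i < s)%N -> ((s.-1 - i).+1 + i)%N = s.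
Proof. by case: s => // s; rewrite ltnS /= addSn => /subnK->. Qed.

Variable R : comUnitRingType.
Hypothesis R_hens : is_henselian R.

(** The Henselian property concerns monic polynomials, while q is arbitrary.
    Substituting z = b / u and multiplying by u^(s+1) / b, where s is the size
    of q, reverses the order of the coefficients and turns the equation into
    a monic one, congruent to u^(s+1) + u^s modulo the maximal ideal, for which
    -1 is a simple root. *)
Lemma hensel_reduced (q : {poly R}) (b : R) : max_ideal b ->
  exists2 z, divides b z & b + z + z ^+ 2 * q.[z] = 0.
Proof.
move=> mb; have [R_local hens] := R_hens.
pose s := size q.
pose r : {poly R} := \sum_(i < s) (b ^+ i * q`_i) *: 'X^(s.-1 - i).
pose M : {poly R} := 'X^(s.+1) + ('X^s + b *: r).
have szr : (size r <= s)%N.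
  apply: (leq_trans (size_sum _ _ _)); apply/bigmax_leqP => i _.
  apply: leq_trans (size_scale_leq _ _) _; rewrite size_polyXn.
  by rewrite -[leqRHS](pred_subK (ltn_ord i)) leq_addr.
have Mmonic : M \is monic.
  rewrite monicE lead_coefDl ?lead_coefXn // size_polyXn ltnS.
  apply: leq_trans (size_polyD _ _) _; rewrite geq_max size_polyXn leqnn /=.
  by apply: leq_trans (size_scale_leq _ _) _; apply: leqW.
have mM : max_ideal M.[-1].
  have -> : M.[-1] = r.[-1] * b.
    rewrite /M !hornerE exprS /=; ring.
  exact: max_ideal_mull.
have dM : ~ max_ideal M^`().[-1].
  apply/max_idealPn.
  have -> : M^`().[-1] =
      ((-1) ^+ s *+ s.+1 + (-1) ^+ s.-1 *+ s) + r^`().[-1] * b.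
    by rewrite /M !derivE !hornerD !hornerMn !hornerXn !hornerE /=; ring.
  apply: max_ideal_unitD => //; last exact: max_ideal_mull.
  suff -> : (-1) ^+ s *+ s.+1 + (-1) ^+ s.-1 *+ s = (-1) ^+ s :> R.
    by rewrite unitrX // unitrN unitr1.
  case: (s) => [|t]; first by rewrite mulr0n addr0.
  by rewrite mulrS /= exprS mulN1r mulNrn addrNK.
have [u /eqP Mu mu1] := hens M (-1) Mmonic mM dM.
have uu : u \is a GRing.unit.
  rewrite -[u](subrK (-1)) addrC max_ideal_unitD //.
  by rewrite unitrN unitr1.
exists (b / u); first by exists u^-1.
have {Mu}: u ^+ s.+1 + u ^+ s + b * r.[u] = 0.
  by rewrite -[RHS]Mu /M !hornerE /=; ring.
have -> : r.[u] = u ^+ s * u^-1 * q.[b / u].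
  rewrite /r horner_sum horner_coef mulr_sumr; apply: eq_bigr => i _.
  rewrite !hornerE /= exprMn exprVn.
  have -> : u ^+ s = u * (u ^+ (s.-1 - i) * u ^+ i).
    by rewrite -exprD -exprS -addSn pred_subK.
  have uV : u * u^-1 = 1 by rewrite divrr.
  have uVi : u ^+ i * u^-1 ^+ i = 1 by rewrite -exprMn uV expr1n.
  rewrite -exprVn.
  transitivity (b ^+ i * q`_i * u ^+ (s.-1 - i) * (u / u) * (u ^+ i * u^-1 ^+ i)).
    by rewrite uV uVi; ring.
  by move: (u^-1) => t; ring.
move=> H; apply: (mulIr (unitrX s.+1 uu)); rewrite mul0r.
transitivity (b * (u ^+ s.+1 + u ^+ s + b * (u ^+ s / u * q.[b / u]))); last first.
  by rewrite H mulr0.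
have us : u ^+ s.+1 = u ^+ s * u by rewrite exprSr.
have uV : u * u^-1 = 1 by rewrite divrr.
rewrite us.
set Y := u^-1 in uV *. set Z := q.[_].
transitivity (b * (u ^+ s * u + u ^+ s *(u* Y) + b * (u ^+ s * Y * (u * Y) * Z))).
  by ring.
by rewrite uV; ring.
Qed.

Lemma poly_taylor2 (P : {poly R}) w : exists q : {poly R}, forall h,
  P.[w + h] = P.[w] + P^`().[w] * h + h ^+ 2 * q.[h].
Proof.
elim/poly_ind: P => [|P c [q IH]].
  by exists 0 => h; rewrite deriv0 !horner0; ring.
exists (P^`().[w]%:P + q * ('X + w%:P)) => h.
by rewrite !derivE !hornerE IH; ring.
Qed.

(** The root is sought as w + a z with a = P'(w): the second order expansion
    of P at w is then a^2 times an equation of the reduced form. *)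
Lemma hensel_scaled (P : {poly R}) (w b : R) : max_ideal b ->
  P.[w] = P^`().[w] ^+ 2 * b ->
  exists2 z, divides b z & root P (w + P^`().[w] * z).
Proof.
move=> mb Pw; have [q Pq] := poly_taylor2 P w.
set a := P^`().[w] in Pw Pq *.
have [z bz z0] := hensel_reduced (q \Po (a *: 'X)) mb.
exists z => //; apply/rootP; rewrite Pq Pw.
move: z0; rewrite horner_comp !hornerE /= => z0.
transitivity (a ^+ 2 * (b + z + z ^+ 2 * q.[a * z])); first by ring.
by rewrite z0 mulr0.
Qed.
End Hensel1.

(** * Taylor expansion in several variables *)

Lemma mpoly_ring_ind (R : comNzRingType) n (K : {mpoly R[n]} -> Prop) :
  (forall c, K c%:MP) -> (forall i, K 'X_i) ->
  (forall p q, K p -> K q -> K (p + q)) ->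
  (forall p q, K p -> K q -> K (p * q)) -> forall p, K p.
Proof.
move=> KC KX KD KM p; rewrite [p]mpolyE.
elim/big_ind: _ => [||m _]; first by rewrite -(mpolyC0 n R); apply: KC.
  exact: KD.
rewrite -mul_mpolyC; apply: (KM) => //; rewrite mpolyXE_id.
elim/big_ind: _ => [||i _]; first by rewrite -(mpolyC1 n R); apply: KC.
  exact: KM.
elim: (m i) => [|d IH]; last by rewrite exprS; apply: KM.
by rewrite expr0 -(mpolyC1 n R); apply: KC.
Qed.

(** K stands for an ideal of R; it is used for the multiples of an element c,
    for the maximal ideal, and for the products of c with the maximal ideal. *)
Lemma meval_congr_ideal (R : comNzRingType) n (K : R -> Prop) :
  K 0 -> (forall a b, K a -> K b -> K (a + b)) ->
  (forall a b, K b -> K (a * b)) ->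
  forall (P : {mpoly R[n]}) (x y : 'I_n -> R),
    (forall i, K (x i - y i)) -> K (P.@[x] - P.@[y]).
Proof.
move=> K0 KD KM P x y Kxy; elim/mpoly_ring_ind: P => [a|i|P Q cP cQ|P Q cP cQ].
- by rewrite !mevalC subrr.
- by rewrite !mevalXU.
- by rewrite !mevalD opprD addrACA; apply: KD.
rewrite !mevalM.
have -> : P.@[x] * Q.@[x] - P.@[y] * Q.@[y] =
  Q.@[x] * (P.@[x] - P.@[y]) + P.@[y] * (Q.@[x] - Q.@[y]) by ring.
by apply: KD; apply: KM.
Qed.

Section Taylor.
Variables (R : comNzRingType) (n : nat).
Implicit Types (P Q : {mpoly R[n]}) (x h : 'I_n -> R) (c : R).

Definition dir_deriv P x h := \sum_i P^`M(i).@[x] * h i.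

Lemma dir_derivC c x h : dir_deriv c%:MP x h = 0.
Proof. by apply: big1 => i _; rewrite mderivC meval0 mul0r. Qed.

Lemma mderivXU (i j : 'I_n) : ('X_i : {mpoly R[n]})^`M(j) = (i == j)%:R.
Proof.
rewrite mderivX mnm1E; case: eqP => [->|_]; last by rewrite scale0r.
suff -> : (U_(j) - U_(j) = 0)%MM by rewrite scale1r mpolyX0.
by apply/mnmP => i'; rewrite mnmBE subnn mnm0E.
Qed.

Lemma dir_derivX i x h : dir_deriv 'X_i x h = h i.
Proof.
rewrite /dir_deriv (bigD1 i) //= mderivXU eqxx meval1 mul1r big1 ?addr0 // => j ji.
by rewrite mderivXU eq_sym (negbTE ji) meval0 mul0r.
Qed.

Lemma dir_derivD P Q x h :
  dir_deriv (P + Q) x h = dir_deriv P x h + dir_deriv Q x h.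
Proof.
rewrite /dir_deriv -big_split /=; apply: eq_bigr => i _.
by rewrite mderivD mevalD mulrDl.
Qed.

Lemma dir_derivM P Q x h :
  dir_deriv (P * Q) x h = dir_deriv P x h * Q.@[x] + P.@[x] * dir_deriv Q x h.
Proof.
rewrite /dir_deriv mulr_suml mulr_sumr -big_split /=; apply: eq_bigr => i _.
by rewrite mderivM mevalD !mevalM; ring.
Qed.

Lemma mpoly_taylor2 P x h c : exists r,
  P.@[fun i => x i + c * h i] = P.@[x] + c * dir_deriv P x h + c ^+ 2 * r.
Proof.
elim/mpoly_ring_ind: P => [a|i|P Q [r Pr] [s Qs]|P Q [r Pr] [s Qs]].
- by exists 0; rewrite !mevalC dir_derivC; ring.
- by exists 0; rewrite !mevalXU dir_derivX; ring.
- by exists (r + s); rewrite !mevalD dir_derivD Pr Qs; ring.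
exists (P.@[x] * s + Q.@[x] * r + dir_deriv P x h * dir_deriv Q x h +
  c * (dir_deriv P x h * s + dir_deriv Q x h * r) + c ^+ 2 * r * s).
by rewrite !mevalM dir_derivM Pr Qs; ring.
Qed.

(** Contrary to [mpoly_taylor2] the remainder is a polynomial in x, and its
    vanishing to order two at 0 is recorded: the remainder is used to build the
    polynomial map of [normal_form]. *)
Lemma mpoly_scale2 P c : exists Q,
  [/\ forall x, P.@[fun i => c * x i] =
        P.@[fun=> 0] + c * dir_deriv P (fun=> 0) x + c ^+ 2 * Q.@[x],
      Q.@[fun=> 0] = 0 & forall k, Q^`M(k).@[fun=> 0] = 0].
Proof.
pose lin P : {mpoly R[n]} := \sum_i P^`M(i).@[fun=> 0] *: 'X_i.
have linE Q x : (lin Q).@[x] = dir_deriv Q (fun=> 0) x.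
  rewrite /lin raddf_sum /=; apply: eq_bigr => i _.
  by rewrite mevalZ mevalXU.
have lin0 Q : (lin Q).@[fun=> 0] = 0.
  by rewrite linE /dir_deriv big1 // => i _; rewrite mulr0.
elim/mpoly_ring_ind: P => [a|i|P Q [r [Pr r0 dr]] [s [Qs s0 ds]]
                                |P Q [r [Pr r0 dr]] [s [Qs s0 ds]]].
- exists 0; split=> [x||k]; rewrite ?mderiv0 ?meval0 //.
  by rewrite !mevalC dir_derivC; ring.
- exists 0; split=> [x||k]; rewrite ?mderiv0 ?meval0 //.
  by rewrite !mevalXU dir_derivX; ring.
- exists (r + s); split=> [x||k]; rewrite ?mderivD ?mevalD.
  + by rewrite Pr Qs dir_derivD; ring.
  + by rewrite r0 s0 addr0.
  + by rewrite dr ds addr0.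
exists (P.@[fun=> 0] *: s + Q.@[fun=> 0] *: r + lin P * lin Q +
  c *: (lin P * s + lin Q * r) + c ^+ 2 *: (r * s)).
split=> [x||k]; rewrite ?mderivD ?mderivZ ?mevalD ?mevalZ ?mderivD ?mderivM
  ?mevalD ?mevalM.
- by rewrite Pr Qs dir_derivM !linE; ring.
- by rewrite !lin0 r0 s0; ring.
- by rewrite ?mevalM !lin0 r0 s0 dr ds; ring.
Qed.

End Taylor.

(** * Eliminating one variable modulo a prime ideal *)

Record is_prime_ideal (B : comNzRingType) (I : B -> Prop) : Prop := PrimeIdeal {
  prime_ideal0 : I 0;
  prime_idealD : forall x y, I x -> I y -> I (x + y);
  prime_idealM : forall x y, I y -> I (x * y);
  prime_ideal1 : ~ I 1;
  prime_idealP : forall x y, I (x * y) -> I x \/ I y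
}.

Record is_subring (B : comNzRingType) (A : B -> Prop) : Prop := Subring {
  subring1 : A 1;
  subringB : forall x y, A x -> A y -> A (x - y);
  subringM : forall x y, A x -> A y -> A (x * y)
}.

Record is_derivation (B : comNzRingType) (D : B -> B) : Prop := Derivation {
  derivationD : forall x y, D (x + y) = D x + D y;
  derivationM : forall x y, D (x * y) = D x * y + x * D y
}.

Definition adjoin (B : comNzRingType) (A : B -> Prop) (t x : B) :=
  exists2 p : {poly B}, (forall i, A p`_i) & x = p.[t].

Section Subring.
Variables (B : comNzRingType) (A : B -> Prop).
Hypothesis subA : is_subring A.

Lemma subring0 : A 0.
Proof. by rewrite -(subrr 1); apply: subringB => //; apply: subring1. Qed.
Lemma subringN x : A x -> A (- x).
Proof. by move=> Ax; rewrite -sub0r; apply: subringB => //; apply: subring0. Qed.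
Lemma subringD x y : A x -> A y -> A (x + y).
Proof. by move=> Ax Ay; rewrite -[y]opprK; apply: subringB => //; apply: subringN. Qed.

Lemma subring_coefC a : A a -> forall i, A (a%:P)`_i.
Proof. by move=> Aa i; rewrite coefC; case: eqP => // _; apply: subring0. Qed.

Lemma adjoin_subring t : is_subring (adjoin A t).
Proof.
split.
- exists 1; last by rewrite hornerC.
  by apply: subring_coefC; apply: subring1.
- move=> _ _ [p Ap ->] [q Aq ->]; exists (p - q); last by rewrite !hornerE.
  by move=> i; rewrite coefB; apply: subringB.
move=> _ _ [p Ap ->] [q Aq ->]; exists (p * q); last by rewrite hornerM.
move=> i; rewrite coefM; elim/big_ind: _ => [|x y|j _].
- exact: subring0.
- exact: subringD.
- by apply: subringM.
Qed.

Lemma adjoin_sub t x : A x -> adjoin A t x.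
Proof. by move=> Ax; exists x%:P; rewrite ?hornerC //; apply: subring_coefC. Qed.

Lemma adjoin_gen t : adjoin A t t.
Proof.
exists 'X; last by rewrite hornerX.
by move=> i; rewrite coefX; case: eqP => // _; [apply: subring1|apply: subring0].
Qed.
End Subring.

Section EliminationStep.
Variables (B : comNzRingType) (I : B -> Prop) (A : B -> Prop) (t : B).
Hypotheses (primeI : is_prime_ideal I) (subA : is_subring A).

Implicit Types (p h : {poly B}).

Let I0 := prime_ideal0 primeI.
Let ID := prime_idealD primeI.
Let IM := prime_idealM primeI.

Lemma prime_idealMr x y : I x -> I (x * y).
Proof. by rewrite mulrC; apply: IM. Qed.
Lemma prime_idealN x : I x -> I (- x).
Proof. by rewrite -mulN1r; apply: IM. Qed.
Lemma prime_idealB x y : I x -> I y -> I (x - y).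
Proof. by move=> Ix Iy; apply: ID => //; apply: prime_idealN. Qed.
Lemma prime_ideal_sum (J : Type) (r : seq J) (P : pred J) (F : J -> B) :
  (forall i, P i -> I (F i)) -> I (\sum_(i <- r | P i) F i).
Proof. by move=> IF; elim/big_ind: _. Qed.
Lemma prime_idealDl x y : I y -> I (x + y) -> I x.
Proof. by move=> Iy Ixy; rewrite -(addrK y x); apply: prime_idealB. Qed.
Lemma prime_idealDr x y : I x -> I (x + y) -> I y.
Proof. by rewrite addrC; apply: prime_idealDl. Qed.

Lemma derivation0 D : is_derivation D -> D (0 : B) = 0.
Proof. by move=> dD; apply: (addIr (D 0)); rewrite -(derivationD dD) !add0r. Qed.

Lemma derivation_horner_coefs D p : is_derivation D ->
  (forall x, A x -> I x -> I (D x)) ->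
  (forall i, A p`_i) -> (forall i, I p`_i) -> I (D p.[t]).
Proof.
move=> dD DI Ap Ip; rewrite horner_coef.
rewrite (big_morph D (derivationD dD) (derivation0 dD)).
apply: prime_ideal_sum => i _; rewrite (derivationM dD).
by apply: ID; apply: prime_idealMr => //; apply: DI.
Qed.

Definition alg_relation p := (forall i, A p`_i) /\ I p.[t].

(** A derivation is determined on A[t] modulo I by its values on A and on t,
    and it respects the relations of t over A as soon as it respects one of
    minimal degree: pseudo-division by h reduces any other relation to relations
    of smaller degree, whose coefficients are all in I. *)
Lemma derivation_relation D h : is_derivation D ->
  (forall x, A x -> I x -> I (D x)) ->
  alg_relation h -> ~ I (lead_coef h) -> I (D h.[t]) ->
  (forall r : {poly B}, alg_relation r -> (size r < size h)%N -> forall i, I r`_i) ->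
  forall p, alg_relation p -> I (D p.[t]).
Proof.
move=> dD DI [Ah Ih] lh Dh hmin p.
have [m] := ubnP (size p); elim: m p => // m IHm p szp [Ap Ip].
have [szph|szph] := ltnP (size p) (size h).
  by apply: derivation_horner_coefs => //; apply: hmin.
have h_gt0 : (0 < size h)%N.
  by rewrite lt0n size_poly_eq0; apply/eqP => h0; apply: lh; rewrite h0 lead_coef0.
pose d := (size p - size h)%N.
pose r := lead_coef h *: p - lead_coef p *: ('X^d * h).
have rt : r.[t] = lead_coef h * p.[t] - lead_coef p * (t ^+ d * h.[t]).
  by rewrite /r !hornerE.
have Ar : alg_relation r.
  split=> [i|]; last first.
    by rewrite rt; apply: prime_idealB; [|do 2!apply: IM => //]; apply: IM.
  rewrite coefB !coefZ coefXnM; apply: subringB => //.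
    by apply: subringM => //; apply: Ah.
  apply: subringM => //; first exact: Ap.
  by case: ifP => // _; apply: subring0.
have szr : (size r < size p)%N.
  rewrite -[leqRHS](prednK (leq_trans h_gt0 szph)) ltnS; apply/leq_sizeP => j.
  rewrite leq_eqVlt => /predU1P[<-|].
    rewrite coefB !coefZ coefXnM ltnNge.
    have -> : (d <= (size p).-1)%N.
      by rewrite /d -subn1 leq_sub2l.
    rewrite /=; have -> : ((size p).-1 - d)%N = (size h).-1.
      by rewrite /d -subn1 subnAC subKn // subn1.
    by rewrite mulrC subrr.
  rewrite prednK ?(leq_trans h_gt0) // => pj.
  rewrite coefB !coefZ coefXnM [p`_j]nth_default // mulr0.
  rewrite [h`_ _]nth_default; last first.
    by rewrite leq_subRL /d ?(leq_trans (leq_subr _ _)) // subnK.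
  by case: ifP; rewrite mulr0 subr0.
have := IHm _ (leq_trans szr szp) Ar.
rewrite rt -mulNr (derivationD dD) !(derivationM dD) => H.
have {}H : I (D (lead_coef h) * p.[t] + lead_coef h * D p.[t]).
  apply: (prime_idealDl _ H).
  by apply: ID; apply: IM; [apply: IM | apply: ID; apply: IM].
have /(prime_idealP primeI) [|//] := prime_idealDr (IM _ Ip) H.
by move/lh.
Qed.

Lemma min_relation : (exists2 p, alg_relation p & exists i, ~ I p`_i) ->
  exists h, [/\ alg_relation h, ~ I (lead_coef h) &
    forall r : {poly B}, alg_relation r -> (size r < size h)%N -> forall i, I r`_i].
Proof.
move=> [p rp pI].
pose K n := `[< exists2 p, alg_relation p /\ size p = n & exists i, ~ I p`_i >].
have exK : exists n, K n by exists (size p); apply/asboolP; exists p.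
case: (ex_minnP exK) => n /asboolP[h [rh szh] [i hi]] nmin; have hi' := hi.
have hmin (r : {poly B}) : alg_relation r -> (size r < size h)%N -> forall i, I r`_i.
  move=> rr szr j; apply: contrapT => rj.
  move: szr; rewrite szh ltnNge => /negP; apply; apply: nmin.
  by apply/asboolP; exists r => //; exists j.
exists h; split=> // lh; apply: hi.
have [Ah Ih] := rh.
have h_gt0 : (0 < size h)%N.
  rewrite lt0n size_poly_eq0; apply/eqP => h0.
  by apply: hi'; rewrite h0 coef0.
pose r := h - lead_coef h *: 'X^((size h).-1).
have rE j : r`_j = h`_j - lead_coef h * (j == (size h).-1)%:R.
  by rewrite coefB coefZ coefXn.
have rr : alg_relation r.
  split=> [j|]; last first.
    rewrite /r hornerD hornerN hornerZ.
    by apply: prime_idealB => //; apply: prime_idealMr.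
  rewrite rE; apply: subringB => //; apply: subringM => //; first exact: Ah.
  by case: eqP => _; [apply: subring1|apply: subring0].
have szr : (size r < size h)%N.
  rewrite -[leqRHS](prednK h_gt0) ltnS; apply/leq_sizeP => j.
  rewrite leq_eqVlt rE => /predU1P[<-|hj].
    by rewrite eqxx mulr1 subrr.
  rewrite gtn_eqF // mulr0 subr0 nth_default //.
  by rewrite -(prednK h_gt0).
have := hmin r rr szr i; rewrite rE => H; apply: (prime_idealDl _ H).
by apply: prime_idealN; apply: prime_idealMr.
Qed.

(** Modulo I, a derivation D of A extends to A[t]: if h is a minimal relation of
    t, the combination (E h(t)) D - (D h(t)) E kills h(t).  This fails only if t
    is transcendental or inseparable over A modulo I; in that case E, which is
    zero on A, respects I on A[t]. *)
Lemma eliminate (D E : B -> B) : is_derivation D -> is_derivation E ->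
  (forall x, A x -> I x -> I (D x)) -> (forall x, A x -> E x = 0) ->
  (forall x, adjoin A t x -> I x -> I (E x)) \/
  exists u v, ~ I u /\ forall x, adjoin A t x -> I x -> I (u * D x + v * E x).
Proof.
move=> dD dE DI EA.
have EI x : A x -> I x -> I (E x) by move=> /EA ->.
have [/min_relation[h [rh lh hmin]]|no_rel] :=
  EM (exists2 p, alg_relation p & exists i, ~ I p`_i); last first.
  left=> _ [p Ap ->] Ip; apply: derivation_horner_coefs => // i.
  by apply: contrapT => pi; apply: no_rel; exists p => //; exists i.
have [IEh|IEh] := EM (I (E h.[t])).
  by left=> _ [p Ap ->] Ip; apply: (derivation_relation dE EI rh lh IEh hmin).
right; exists (E h.[t]), (- D h.[t]); split=> // _ [p Ap ->] Ip.
pose F x := E h.[t] * D x + - D h.[t] * E x.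
have dF : is_derivation F.
  split=> x y; rewrite /F (derivationD dD, derivationM dD).
    by rewrite (derivationD dE); ring.
  by rewrite (derivationM dE); ring.
apply: (derivation_relation dF _ rh lh _ hmin) => // [x Ax Ix|].
  by rewrite /F (EA x Ax) mulr0 addr0; apply: IM; apply: DI.
have -> : F h.[t] = 0 by rewrite /F; ring.
exact: I0.
Qed.
End EliminationStep.

(** * The Jacobian criterion for separable algebraic dependence *)

Section Elimination.
Variables (R : comUnitRingType) (n : nat).
Local Notation B := {mpoly R[n]}.
Implicit Types (P : B) (a : 'I_n -> B) (s : seq 'I_n).

Definition der a P : B := \sum_j a j * P^`M(j).

Lemma der_derivation a : is_derivation (der a).
Proof.
split=> P Q; rewrite /der.
  by rewrite -big_split /=; apply: eq_bigr => j _; rewrite mderivD mulrDr.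
rewrite mulr_suml mulr_sumr -big_split /=; apply: eq_bigr => j _.
by rewrite mderivM; ring.
Qed.

Lemma mderiv_derivation (k : 'I_n) : is_derivation (fun P : B => P^`M(k)).
Proof. by split=> P Q; [rewrite mderivD | rewrite mderivM]. Qed.

Lemma der_delta k P : der (fun j => (j == k)%:R) P = P^`M(k).
Proof.
rewrite /der (bigD1 k) //= eqxx mul1r big1 ?addr0 // => j /negbTE ->.
by rewrite mul0r.
Qed.

Fixpoint poly_in s : B -> Prop :=
  if s is k :: s' then adjoin (poly_in s') 'X_k else fun P => exists c, P = c%:MP.

Lemma poly_in_subring s : is_subring (poly_in s).
Proof.
elim: s => [|k s IH] /=; last exact: adjoin_subring.
split=> [|_ _ [c ->] [d ->]|_ _ [c ->] [d ->]].
- by exists 1; rewrite mpolyC1.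
- by exists (c - d); rewrite mpolyCB.
- by exists (c * d); rewrite mpolyCM.
Qed.

Lemma poly_in_C s c : poly_in s c%:MP.
Proof.
by elim: s => [|k s IH] /=; [exists c | apply: adjoin_sub => //; apply: poly_in_subring].
Qed.

Lemma poly_in_X s j : j \in s -> poly_in s 'X_j.
Proof.
elim: s => //= k s IH; rewrite inE => /predU1P[->|js].
  by apply: adjoin_gen; apply: poly_in_subring.
by apply: adjoin_sub; [apply: poly_in_subring | apply: IH].
Qed.

Lemma poly_in_all s P : (forall j, j \in s) -> poly_in s P.
Proof.
move=> sT; have sS := poly_in_subring s.
elim/mpoly_ring_ind: P => [c|i|P Q|P Q].
- exact: poly_in_C.
- by apply: poly_in_X.
- exact: subringD.
- exact: subringM.
Qed.

Lemma mderiv_poly_in s k P : k \notin s -> poly_in s P -> P^`M(k) = 0.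
Proof.
elim: s P => [|j s IH] P /=; first by move=> _ [c ->]; apply: mderivC.
rewrite inE negb_or => /andP[kj ks] [p Ap ->].
have Xk (i : nat) : (('X_j : B) ^+ i)^`M(k) = 0.
  elim: i => [|i IHi]; first by rewrite expr0 -mpolyC1 mderivC.
  by rewrite exprS mderivM IHi mderivXU (eq_sym j) (negbTE kj) mul0r mulr0 addr0.
rewrite horner_coef raddf_sum big1 //= => i _.
by rewrite mderivM Xk (IH _ ks (Ap i)); ring.
Qed.

Variable I : B -> Prop.
Hypothesis primeI : is_prime_ideal I.

Let I0 := prime_ideal0 primeI.
Let IM := prime_idealM primeI.

(** A derivation over R from the image of R[X_j, j in s] in R[X] / I to R[X] / I
    is given by its values a j on the variables; all of them vanish modulo I.
    For a field extension this amounts to being separable algebraic. *)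
Definition rigid s := forall a, (forall j, j \notin s -> a j = 0) ->
  (forall P, poly_in s P -> I P -> I (der a P)) -> forall j, I (a j).

(** A nonzero derivation of R[X_j, j in s] either extends to the larger ring, up
    to a factor outside I, or else differentiation in X_k is a nonzero
    derivation of the larger ring. *)
Lemma rigid_behead k s : k \notin s -> rigid (k :: s) -> rigid s.
Proof.
move=> ks Hks a a0 aI.
have [H|[u [v [Iu H]]]] := eliminate 'X_k primeI (poly_in_subring s)
  (der_derivation a) (mderiv_derivation k) aI (fun P => @mderiv_poly_in s k P ks).
  exfalso; apply: (prime_ideal1 primeI).
  suff Hk : forall j, I (j == k)%:R by move: (Hk k); rewrite eqxx.
  apply: (Hks (fun j => (j == k)%:R)) => [j|P Ps IP].
    by rewrite inE negb_or => /andP[/negbTE ->].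
  by rewrite der_delta; apply: H.
have uI : forall j, I (u * a j + v * (j == k)%:R).
  apply: (Hks (fun j => u * a j + v * (j == k)%:R)) => [j|P Ps IP].
    rewrite inE negb_or => /andP[/negbTE -> js].
    by rewrite (a0 _ js) !mulr0 addr0.
  have -> : der (fun j => u * a j + v * (j == k)%:R) P = u * der a P + v * P^`M(k).
    rewrite -(der_delta k) /der !mulr_sumr -big_split /=.
    by apply: eq_bigr => j _; ring.
  exact: H.
move=> j; have [->|jk] := eqVneq j k; first by rewrite a0.
have := uI j; rewrite (negbTE jk) mulr0 addr0.
by case/(prime_idealP primeI) => // /Iu.
Qed.

Lemma rigid_last l i : uniq (rcons l i) -> rigid (rcons l i) -> rigid [:: i].
Proof.
elim: l => //= k l IH /andP[kl ul] /(rigid_behead kl); exact: IH.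
Qed.

(** The coefficients of a derivation that kills all f i modulo I form a vector in
    the kernel of the Jacobian matrix; multiplying by the adjugate matrix shows
    that the Jacobian determinant annihilates it modulo I. *)
Lemma jacobian_rigid (f : 'I_n -> B) s : (forall j, j \in s) ->
  (forall i, I (f i)) -> ~ I (jacobian f) -> rigid s.
Proof.
move=> sT If IJ a _ aI i.
have Ider j : I (\sum_k (f j)^`M(k) * a k).
  have := aI (f j) (poly_in_all (f j) sT) (If j).
  by congr I; apply: eq_bigr => k _; rewrite mulrC.
pose M : 'M[B]_n := \matrix_(i, j) (f i)^`M(j).
pose A : 'cV[B]_n := \col_k a k.
have IMA j : I ((M *m A) j 0).
  rewrite !mxE; have := Ider j; congr I; apply: eq_bigr => k _.
  by rewrite !mxE.
have : I ((\adj M *m (M *m A)) i 0).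
  by rewrite mxE; apply: prime_ideal_sum => // j _; apply: IM.
rewrite mulmxA mul_adj_mx mul_scalar_mx !mxE.
by case/(prime_idealP primeI).
Qed.

(** All variables but X_i are eliminated.  What remains is that differentiation
    in X_i does not respect I on R[X_i]. *)
Theorem separable_relation (f : 'I_n -> B) (i : 'I_n) :
  (forall i, I (f i)) -> ~ I (jacobian f) ->
  exists P : {poly R}, I (map_poly (@mpolyC n R) P).['X_i] /\
    ~ I (map_poly (@mpolyC n R) P^`()).['X_i].
Proof.
move=> If IJ; pose s := rcons (rem i (enum 'I_n)) i.
have us : uniq s.
  by rewrite rcons_uniq rem_uniq ?enum_uniq // mem_rem_uniq ?enum_uniq // !inE eqxx.
have sT j : j \in s.
  rewrite mem_rcons inE mem_rem_uniq ?enum_uniq // !inE mem_enum.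
  by case: eqP.
have Hi := rigid_last us (jacobian_rigid sT If IJ).
apply: contrapT => noP.
apply: (prime_ideal1 primeI).
suff Ii : forall j, I (j == i)%:R by move: (Ii i); rewrite eqxx.
apply: (Hi (fun j => (j == i)%:R)) => [j|_ [p Ap ->] Ip].
  by rewrite inE => /negbTE ->.
rewrite der_delta.
pose q : {poly R} := map_poly (mcoeff 0%MM) p.
have pE : p = map_poly (@mpolyC n R) q.
  apply/polyP => j; rewrite !coef_map /=.
  by have [c ->] := Ap j; rewrite mcoeffC eqxx mulr1.
have dE : (map_poly (@mpolyC n R) q).['X_i]^`M(i) =
    (map_poly (@mpolyC n R) q^`()).['X_i].
  elim/poly_ind: (q) => [|r c IH].
    by rewrite deriv0 !rmorph0 !horner0 mderiv0.
  rewrite !derivE !(rmorphD, rmorphM) /= !map_polyX map_polyC !hornerE /=.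
  by rewrite mderivD mderivM mderivC IH mderivXU eqxx mulr1 addr0 addrC.
rewrite pE dE; rewrite pE in Ip.
by apply: contrapT => Idq; apply: noP; exists q.
Qed.

End Elimination.

(** * Hensel's lemma in several variables *)

Definition in_m (R : comUnitRingType) n (x : 'I_n -> R) :=
  forall i, max_ideal (x i).

Section MultiHensel.
Variable R : idomainType.
Hypothesis R_hens : is_henselian R.
Hypothesis div_total : forall a b : R, divides a b \/ divides b a.

Let R_local := proj1 R_hens.

Lemma divides_nonunit (a b : R) : ~ divides b a ->
  exists2 s, b = a * s & max_ideal s.
Proof.
move=> ba; have [//|[s bE]] := div_total b a.
exists s => //; apply: contrapT => /max_idealPn us.
by apply: ba; exists s^-1; rewrite bE mulrK.
Qed.

Lemma min_divisor n (y : 'I_n -> R) (i : 'I_n) :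
  exists i0, forall j, divides (y i0) (y j).
Proof.
suff H (s : seq 'I_n) : exists i0, forall j, j \in i :: s -> divides (y i0) (y j).
  by have [i0 Hi] := H (enum 'I_n); exists i0 => j; apply: Hi; rewrite inE mem_enum orbT.
elim: s => [|k s [i0 IH]].
  by exists i => j; rewrite inE => /eqP ->; apply: divides_refl.
have [ik|ki] := div_total (y i0) (y k).
  by exists i0 => j; rewrite !inE orbCA => /predU1P[-> //|js]; apply: IH; rewrite inE.
exists k => j; rewrite !inE orbCA => /predU1P[->|js]; first exact: divides_refl.
by apply: (divides_trans ki); apply: IH; rewrite inE.
Qed.

Lemma primitive_part n (y : 'I_n -> R) : (exists i, y i <> 0) ->
  exists u i, [/\ y i <> 0, u i = 1 & forall j, y j = y i * u j].
Proof.
move=> [i1 yi1]; have [i yi] := min_divisor y i1.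
have yi0 : y i <> 0.
  by move=> yi0; apply: yi1; have [b] := yi i1; rewrite yi0 mul0r.
have [u uE] := choice yi.
exists u, i; split=> //; apply: (mulfI (introN eqP yi0)).
by rewrite -uE mulr1.
Qed.

Variables (n : nat) (f : 'I_n -> {mpoly R[n]}).

Hypothesis f0 : in_m (fun j => (f j).@[fun=> 0]).
Hypothesis J0 : (jacobian f).@[fun=> 0] \is a GRing.unit.

Lemma in_m0 : in_m ((fun=> 0) : 'I_n -> R). Proof. by move=> i; apply: max_ideal0. Qed.

Lemma meval_max_ideal (P : {mpoly R[n]}) x y : in_m x -> in_m y ->
  max_ideal (P.@[x] - P.@[y]).
Proof.
move=> mx my; apply: meval_congr_ideal => [|||i].
- exact: max_ideal0.
- exact: R_local.
- exact: max_ideal_mull.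
- exact: max_idealB.
Qed.

Lemma f_in_m x : in_m x -> in_m (fun j => (f j).@[x]).
Proof.
move=> mx j; rewrite -[(f j).@[x]](subrK (f j).@[fun=> 0]).
by apply: R_local; [apply: meval_max_ideal => //; apply: in_m0 | apply: f0].
Qed.

Lemma jacobian_unit x : in_m x -> (jacobian f).@[x] \is a GRing.unit.
Proof.
move=> mx; rewrite -[(jacobian f).@[x]](subrK (jacobian f).@[fun=> 0]) addrC.
by apply: max_ideal_unitD => //; apply: meval_max_ideal => //; apply: in_m0.
Qed.

Definition jac_at x : 'M[R]_n := \matrix_(i, j) (f i)^`M(j).@[x].

Lemma det_jac_at x : \det (jac_at x) = (jacobian f).@[x].
Proof.
rewrite /jacobian -det_map_mx; congr (\det _).
by apply/matrixP => i j; rewrite !mxE.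
Qed.

Lemma dir_deriv_jac_at x h j :
  dir_deriv (f j) x h = (jac_at x *m \col_k h k) j 0.
Proof. by rewrite mxE; apply: eq_bigr => k _; rewrite !mxE. Qed.

Lemma jac_at_primitive x u i : in_m x -> u i = 1 ->
  exists j, dir_deriv (f j) x u \is a GRing.unit.
Proof.
move=> mx ui; apply: contrapT => H.
have mMu j : max_ideal ((jac_at x *m \col_k u k) j 0).
  by rewrite -dir_deriv_jac_at; apply: contrapT => /max_idealPn ?; apply: H; exists j.
have : max_ideal ((\adj (jac_at x) *m (jac_at x *m \col_k u k)) i 0).
  by rewrite mxE; apply: max_ideal_sum => // j; apply: max_ideal_mull.
rewrite mulmxA mul_adj_mx mul_scalar_mx !mxE ui mulr1 det_jac_at.
by apply/max_idealPn; apply: jacobian_unit.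
Qed.

(** Write x - y = d u with u primitive and d in the maximal ideal.  Then
    f x - f y = d (J u + d r) where J is the Jacobian matrix at y, and J u has
    a unit entry because J is invertible. *)
Lemma f_expanding x y i : in_m x -> in_m y ->
  exists j, divides ((f j).@[x] - (f j).@[y]) (x i - y i).
Proof.
move=> mx my.
have [xy|/eqP xyi0] := eqVneq (x i - y i) 0.
  by exists i; rewrite xy; apply: divides0.
have [u [k [xyk uk xyE]]] :=
  @primitive_part _ (fun i => x i - y i) (ex_intro _ i xyi0).
set d := x k - y k in xyk xyE.
have md : max_ideal d by apply: max_idealB.
have [j uj] := jac_at_primitive my uk.
exists j; have [r fx] := mpoly_taylor2 (f j) y u d.
have <- : (f j).@[fun i => y i + d * u i] = (f j).@[x].
  by apply: meval_eq => l; rewrite -xyE addrC subrK.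
rewrite fx; set D := dir_deriv _ _ _ in uj *.
have -> : (f j).@[y] + d * D + d ^+ 2 * r - (f j).@[y] = d * (D + r * d) by ring.
have uw : D + r * d \is a GRing.unit.
  by apply: max_ideal_unitD => //; apply: max_ideal_mull.
by exists ((D + r * d)^-1 * u i); rewrite mulrA mulrK.
Qed.

Lemma newton_step x c : in_m x -> max_ideal c ->
  (forall j, divides c (f j).@[x]) ->
  exists2 y, in_m y & forall j, divides (c ^+ 2) (f j).@[y].
Proof.
move=> mx mc /choice[b bE].
pose h : 'cV[R]_n := - invmx (jac_at x) *m \col_k b k.
exists (fun i => x i + c * h i 0) => [i|j].
  by apply: R_local => //; rewrite mulrC; apply: max_ideal_mull.
have [r ->] := mpoly_taylor2 (f j) x (fun i => h i 0) c.
exists r; rewrite bE dir_deriv_jac_at.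
have -> : \col_k h k 0 = h by apply/matrixP => k l; rewrite mxE ord1.
rewrite /h mulNmx mulmxN mulKVmx; last by rewrite unitmxE det_jac_at jacobian_unit.
by rewrite !mxE; ring.
Qed.

Definition approx c x := in_m x /\ forall j, divides c (f j).@[x].
Definition reached c := exists x, approx c x.

Lemma approx_divides c d x : divides c d -> approx d x -> approx c x.
Proof. by move=> cd [mx dx]; split=> // j; apply: divides_trans (dx j). Qed.

Lemma reached1 : reached 1.
Proof.
exists (fun=> 0); split=> [|j]; first exact: in_m0.
by exists (f j).@[fun=> 0]; rewrite mul1r.
Qed.

Lemma reached_sqr c : reached c -> reached (c ^+ 2).
Proof.
move=> [x [mx cx]]; have [mc|/max_idealPn uc] := EM (max_ideal c).
  by have [y my cy] := newton_step mx mc cx; exists y.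
exists x; split=> // j; exists ((f j).@[x] / c ^+ 2).
by rewrite mulrC divrK // unitrX.
Qed.

Lemma reachedM c d : reached c -> reached d -> reached (c * d).
Proof.
move=> /reached_sqr[x cx] /reached_sqr[y dy].
have [cd|dc] := div_total c d.
  by exists y; apply: approx_divides dy; apply: dividesM => //; apply: divides_refl.
by exists x; apply: approx_divides cx; apply: dividesM => //; apply: divides_refl.
Qed.

Lemma reached_prod (I : finType) (c : I -> R) :
  (forall i, reached (c i)) -> reached (\prod_i c i).
Proof. by move=> rc; elim/big_ind: _ => //; [apply: reached1 | apply: reachedM]. Qed.

Lemma approx_congr c x y i : approx c x -> approx c y -> divides c (x i - y i).
Proof.
move=> [mx cx] [my cy]; have [j] := f_expanding i mx my.
by apply: divides_trans; apply: dividesB.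
Qed.

Lemma approx_meval_congr c x y (P : {mpoly R[n]}) :
  approx c x -> approx c y -> divides c (P.@[x] - P.@[y]).
Proof.
move=> cx cy; apply: meval_congr_ideal => [|||i].
- exact: divides0.
- exact: dividesD.
- by move=> a b; apply: divides_mull.
- exact: approx_congr.
Qed.

(** By [approx_meval_congr], P takes the same value modulo c at all approximate
    zeros to precision c.  The condition therefore says that the limit of the
    values of P along ever better approximate zeros is 0. *)
Definition limit_ideal (P : {mpoly R[n]}) :=
  forall c x, approx c x -> divides c P.@[x].

Section NoZero.
Hypothesis no_zero : ~ exists2 x, in_m x & forall j, (f j).@[x] = 0.

Lemma value_primitive x : in_m x ->
  exists j, let g := (f j).@[x] in [/\ g <> 0, max_ideal g & approx g x].
Proof.
move=> mx.
have [|u [j [gj uj gE]]] := @primitive_part _ (fun j => (f j).@[x]).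
  apply: contrapT => H; apply: no_zero; exists x => // j.
  by apply: contrapT => fj; apply: H; exists j.
exists j => g; split=> //; first exact: f_in_m.
by split=> // k; exists (u k); apply: gE.
Qed.

Lemma limit_ideal_unit (P : {mpoly R[n]}) : P.@[fun=> 0] \is a GRing.unit ->
  ~ limit_ideal P.
Proof.
move=> uP IP; have [j [_ mg gx]] := value_primitive in_m0.
have := max_ideal_divides (IP _ _ gx) mg.
exact/max_idealPn.
Qed.

(** If P and Q do not tend to 0, then neither does P * Q, since its limit is not
    divisible by the product c * d of the precisions that detect P and Q; this
    precision is attained because reached elements are closed under products. *)
Lemma limit_ideal_prime : is_prime_ideal limit_ideal.
Proof.
split=> [c x _|P Q IP IQ c x cx|P Q IQ c x cx||P Q IPQ].
- by rewrite meval0; apply: divides0.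
- by rewrite mevalD; apply: dividesD; [apply: IP | apply: IQ].
- by rewrite mevalM; apply: divides_mull; apply: IQ.
- by apply: limit_ideal_unit; rewrite meval1 unitr1.
have stays S c x w : approx c x -> ~ divides c S.@[x] -> approx c w ->
    ~ divides c S.@[w].
  move=> cx cS cw cSw; apply: cS; rewrite -[S.@[x]](subrK S.@[w]).
  by apply: dividesD => //; apply: approx_meval_congr.
have [|nIP] := EM (limit_ideal P); first by left.
have [|nIQ] := EM (limit_ideal Q); first by right.
exfalso.
have [c [x [cx cP]]] : exists c x, approx c x /\ ~ divides c P.@[x].
  apply: contrapT => H; apply: nIP => c x cx; apply: contrapT => cP.
  by apply: H; exists c, x.
have [d [y [dy dQ]]] : exists d y, approx d y /\ ~ divides d Q.@[y].
  apply: contrapT => H; apply: nIQ => d y dy; apply: contrapT => dQ.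
  by apply: H; exists d, y.
have [w cdw] := reachedM (ex_intro _ x cx) (ex_intro _ y dy).
have cw : approx c w by apply: approx_divides cdw; exists d.
have dw : approx d w by apply: approx_divides cdw; exists c; rewrite mulrC.
have cPw := stays _ _ _ _ cx cP cw; have dQw := stays _ _ _ _ dy dQ dw.
have [s cE ms] := divides_nonunit cPw.
have [t dE _] := divides_nonunit dQw.
have [k] := IPQ _ _ cdw; rewrite mevalM cE dE => PQE.
have PQ0 : P.@[w] * Q.@[w] != 0.
  rewrite mulf_eq0 negb_or; apply/andP; split; apply/eqP => S0.
    by apply: cPw; rewrite S0; apply: divides0.
  by apply: dQw; rewrite S0; apply: divides0.
have : s * (t * k) = 1.
  by apply: (mulfI PQ0); rewrite mulr1 [RHS]PQE; ring.
move=> stk; have : max_ideal (1 : R) by rewrite -stk mulrC; apply: max_ideal_mull.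
by apply/max_idealPn; apply: unitr1.
Qed.

Lemma meval_map_polyX (q : {poly R}) i (x : 'I_n -> R) :
  (map_poly (@mpolyC n R) q).['X_i].@[x] = q.[x i].
Proof.
elim/poly_ind: q => [|q c IH]; first by rewrite rmorph0 !horner0 meval0.
rewrite !(rmorphD, rmorphM) /= map_polyX map_polyC !hornerE /=.
by rewrite mevalD mevalM IH mevalC mevalXU.
Qed.

Lemma horner_congr c (p : {poly R}) x y : divides c (x - y) -> divides c (p.[x] - p.[y]).
Proof.
move=> cxy; have [q pE] := poly_taylor2 p y.
have := pE (x - y); rewrite addrC subrK => ->.
set h := x - y in cxy *.
have -> : p.[y] + p^`().[y] * h + h ^+ 2 * q.[h] - p.[y] = h * (p^`().[y] + h * q.[h]).
  by ring.
exact: divides_mulr.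
Qed.

(** Each P_i' is outside the limit ideal, hence stays nonzero modulo some reached
    element; the product of these elements serves all coordinates at once. *)
Lemma root_family : exists (P : 'I_n -> {poly R}) (c : R),
  [/\ reached c,
      forall i d w, approx d w -> divides d (P i).[w i] &
      forall i w, approx c w -> ~ divides c (P i)^`().[w i]].
Proof.
have IJ : ~ limit_ideal (jacobian f) by apply: limit_ideal_unit.
have If i : limit_ideal (f i) by move=> c x [_ cx]; apply: cx.
have [P HP] := choice (fun i => separable_relation limit_ideal_prime i If IJ).
have /choice[c Hc] i : exists c, reached c /\
    forall w, approx c w -> ~ divides c (P i)^`().[w i].
  have [_ dP] := HP i; apply: contrapT => H; apply: dP => c x cx.
  apply: contrapT; rewrite meval_map_polyX => cP; apply: H.
  exists c; split; first by exists x.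
  move=> w cw cPw; apply: cP; rewrite -[_.[x i]](subrK (P i)^`().[w i]).
  by apply: dividesD => //; apply: horner_congr; apply: approx_congr.
exists P, (\prod_i c i); split=> [|i d w dw|i w cw cP].
- by apply: reached_prod => i; have [] := Hc i.
- by rewrite -meval_map_polyX; have [IP _] := HP i; apply: IP.
have cic : divides (c i) (\prod_i c i).
  by rewrite (bigD1 i) //=; apply: divides_mulr; apply: divides_refl.
have [_] := Hc i; apply; first exact: approx_divides cw.
exact: divides_trans cic cP.
Qed.

Lemma no_zero_absurd : False.
Proof.
have [P [c [rc IP dP]]] := root_family.
have mc : max_ideal c.
  apply: contrapT => /max_idealPn uc; have [w cw] := rc.
  have [j _] := value_primitive in_m0.
  by apply: (dP j w cw); exists (c^-1 * (P j)^`().[w j]); rewrite mulVKr.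
have near d : reached d -> exists w xi, [/\ approx c w, approx d w &
    forall i, [/\ root (P i) (xi i), divides c (xi i - w i) & divides d (xi i - w i)]].
  move=> rd.
  (* Precision c^2 d makes P_i(w i) divisible by a^2 s^2 d, where a = P_i'(w i)
     and c = a s: the s^2 d left after division by a^2 puts the root within
     a s^2 d = c s d of w i. *)
  have [w cdw] := reachedM (reached_sqr rc) rd.
  have cw : approx c w.
    by apply: approx_divides cdw; exists (c * d); rewrite mulrA expr2.
  have dw : approx d w by apply: approx_divides cdw; exists (c ^+ 2); rewrite mulrC.
  suff /choice[xi Hxi] i : exists xi, [/\ root (P i) xi, divides c (xi - w i) &
      divides d (xi - w i)] by exists w, xi.
  set a := (P i)^`().[w i].
  have [s cE ms] := divides_nonunit (dP i w cw).
  have [k Pw] := IP i _ _ cdw.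
  have mb : max_ideal (s ^+ 2 * d * k).
    by rewrite expr2 -!mulrA mulrC; apply: max_ideal_mull.
  have [|z [l zE] rz] := hensel_scaled R_hens mb (P := P i) (w := w i).
    by rewrite Pw {1}cE -/a; ring.
  exists (w i + a * z); split=> //; rewrite [w i + _]addrC addrK zE.
    by exists (s * d * k * l); rewrite [in RHS]cE -/a; ring.
  by exists (a * s ^+ 2 * k * l); ring.
have [w0 [xi [cw0 _ Hxi]]] := near 1 reached1.
have mxi : in_m xi.
  move=> i; rewrite -[xi i](subrK (w0 i)); have [_ ci _] := Hxi i.
  by apply: R_local; [apply: max_ideal_divides ci mc | apply: (proj1 cw0)].
have fxi d j : reached d -> divides d (f j).@[xi].
  move=> /near[w [xi' [cw dw Hxi']]].
  (* Two distinct roots at distance h, with c dividing h, would force c to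
     divide the derivative. *)
  have xiE i : xi' i = xi i.
    have [rx cx _] := Hxi i; have [rx' cx' _] := Hxi' i.
    apply/eqP; rewrite -subr_eq0; apply: contrapT => /negP h0.
    set h := xi' i - xi i in h0.
    have ch : divides c h.
      have -> : h = (xi' i - w i) - (xi i - w0 i) + (w i - w0 i) by rewrite /h; ring.
      by apply: dividesD; [apply: dividesB | apply: approx_congr].
    have [q PE] := poly_taylor2 (P i) (xi i).
    have := PE h; rewrite /h addrC subrK -/h.
    rewrite (rootP rx) (rootP rx') add0r => H.
    have {}H : (P i)^`().[xi i] = - h * q.[h].
      apply: (mulIf h0); apply/eqP; rewrite -subr_eq0 [X in _ == X]H; apply/eqP; ring.
    apply: (dP i w0 cw0); rewrite -[_.[w0 i]](subKr (P i)^`().[xi i]).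
    apply: dividesB; first by rewrite H mulNr -mulrN; apply: divides_mulr.
    exact: horner_congr.
  rewrite -[(f j).@[xi]](subrK (f j).@[w]); apply: dividesD; last by have [] := dw.
  apply: meval_congr_ideal => [|||i]; [exact: divides0 | exact: dividesD | |].
    by move=> a b; apply: divides_mull.
  by rewrite -xiE; have [] := Hxi' i.
have [j [g0 mg gx]] := value_primitive mxi.
have [k gE] := fxi _ j (reached_sqr (ex_intro _ xi gx)).
have : (f j).@[xi] * k = 1.
  by apply: (mulfI (introN eqP g0)); rewrite mulr1 [RHS]gE; ring.
move=> gk; have : max_ideal (1 : R) by rewrite -gk mulrC; apply: max_ideal_mull.
by apply/max_idealPn; apply: unitr1.
Qed.
End NoZero.

Theorem multi_hensel : exists2 x, in_m x & forall j, (f j).@[x] = 0.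
Proof. by apply: contrapT; apply: no_zero_absurd. Qed.

End MultiHensel.

(** * Reduction to an identity linear part *)

Definition in_mv (R : comUnitRingType) n (x : 'rV[R]_n) := in_m (x 0).

Section Normalization.
Variable R : idomainType.
Hypothesis R_hens : is_henselian R.
Hypothesis div_total : forall a b : R, divides a b \/ divides b a.
Variables (n : nat) (f : 'I_n -> {mpoly R[n]}) (e : R).
Hypothesis f0 : forall j, (f j).@[fun=> 0] = 0.
Hypothesis eE : e = (jacobian f).@[fun=> 0].
Hypothesis e_neq0 : e != 0.

Let R_local := proj1 R_hens.
Local Notation M := (jac_at f (fun=> 0)).

Lemma adj_jac0 : \adj M *m M = e%:M.
Proof. by rewrite mul_adj_mx det_jac_at -eE. Qed.
Lemma jac0_adj : M *m \adj M = e%:M.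
Proof. by rewrite mul_mx_adj det_jac_at -eE. Qed.

Lemma normal_form : exists F : 'I_n -> {mpoly R[n]},
  [/\ forall x j, (f j).@[fun i => e ^+ 2 * x i] =
        e ^+ 2 * (M *m \col_k (F k).@[x]) j 0,
      forall k, (F k).@[fun=> 0] = 0 & jac_at F (fun=> 0) = 1%:M].
Proof.
have [Q HQ] := choice (fun j => mpoly_scale2 (f j) (e ^+ 2)).
pose F k : {mpoly R[n]} := 'X_k + e *: \sum_j (\adj M) k j *: Q j.
have FE x k : (F k).@[x] = x k + e * \sum_j (\adj M) k j * (Q j).@[x].
  rewrite /F mevalD mevalXU mevalZ raddf_sum /=; congr (_ + _ * _).
  by apply: eq_bigr => j _; rewrite mevalZ.
exists F; split=> [x j|k|].
- have [-> _ _] := HQ j; rewrite f0 add0r dir_deriv_jac_at.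
  have -> : \col_k (F k).@[x] = \col_k x k + e *: (\adj M *m \col_k (Q k).@[x]).
    apply/colP => k; rewrite !mxE FE; congr (_ + _ * _).
    by apply: eq_bigr => l _; rewrite !mxE.
  rewrite mulmxDr -scalemxAr mulmxA jac0_adj mul_scalar_mx !mxE; ring.
- rewrite FE add0r big1 ?mulr0 // => j _.
  by have [_ -> _] := HQ j; rewrite mulr0.
apply/matrixP => k l; rewrite !mxE /F mderivD mderivXU mderivZ mevalD mevalZ.
rewrite (big_morph (mderiv l) (mderivD l) (@mderiv0 _ _ l)) raddf_sum.
rewrite big1 ?mulr0 ?addr0 => [|j _].
  by case: eqP; rewrite ?meval1 ?meval0.
by rewrite mderivZ /= mevalZ; have [_ _ ->] := HQ j; rewrite mulr0.
Qed.

Lemma normal_form_bijective (F : 'I_n -> {mpoly R[n]}) :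
  (forall k, (F k).@[fun=> 0] = 0) -> jac_at F (fun=> 0) = 1%:M ->
  [/\ forall x, in_m x -> in_m (fun k => (F k).@[x]),
      forall b, in_m b -> exists2 x, in_m x & forall k, (F k).@[x] = b k &
      forall x y i, in_m x -> in_m y ->
        exists j, divides ((F j).@[x] - (F j).@[y]) (x i - y i)].
Proof.
move=> F0 JF.
have mF0 : in_m (fun j => (F j).@[fun=> 0]) by move=> j; rewrite F0; apply: max_ideal0.
have uJF : (jacobian F).@[fun=> 0] \is a GRing.unit.
  by rewrite -det_jac_at JF det1 unitr1.
split.
- exact: f_in_m.
- move=> b mb; pose Fb k := F k - (b k)%:MP.
  have [||x mx Fx] := @multi_hensel R R_hens div_total n Fb.
  + by move=> j; rewrite /Fb mevalB F0 mevalC sub0r; apply/max_idealN.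
  + rewrite -det_jac_at.
    suff -> : jac_at Fb (fun=> 0) = 1%:M by rewrite det1 unitr1.
    by rewrite -JF; apply/matrixP => k l; rewrite !mxE /Fb mderivB mderivC subr0.
  exists x => // k; apply/eqP; rewrite -subr_eq0 -[X in _ - X](mevalC x) -mevalB.
  by apply/eqP; apply: Fx.
- by move=> x y i; apply: f_expanding.
Qed.

Lemma polymap_scaled F (x : 'rV[R]_n) :
  (forall x j, (f j).@[fun i => e ^+ 2 * x i] =
     e ^+ 2 * (M *m \col_k (F k).@[x]) j 0) ->
  polymap f (e ^+ 2 *: x) = e ^+ 2 *: (M *m \col_k (F k).@[fun i => x 0 i])^T.
Proof.
move=> fE; apply/rowP => j; rewrite !mxE /=.
rewrite (_ : (f j).@[_] = (f j).@[fun i => e ^+ 2 * x 0 i]); last first.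
  by apply: meval_eq => i; rewrite mxE.
by rewrite fE !mxE.
Qed.

Local Notation A := (scaled_max_ideal_power (n := n) (e ^+ 2)).

Lemma in_m_mulmx p q (N : 'M[R]_(p, q)) (y : 'cV[R]_q) j :
  (forall k, max_ideal (y k 0)) -> max_ideal ((N *m y) j 0).
Proof.
by move=> my; rewrite mxE; apply: max_ideal_sum => // k; apply: max_ideal_mull.
Qed.

Theorem scaled_image_sub a : A a -> scaled_max_ideal_power e (polymap f a).
Proof.
move=> [x mx <-]; have [F [fE F0 JF]] := normal_form.
have [mF _ _] := normal_form_bijective F0 JF.
rewrite (polymap_scaled _ fE) expr2 -scalerA.
eexists; last by reflexivity.
move=> j; rewrite 2!mxE; apply: max_ideal_mull; apply: in_m_mulmx => k.
by rewrite mxE; apply: mF.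
Qed.

(** The image is e^2 M m^n, and e^3 h = e^2 M (adj M h). *)
Theorem scaled_image_open a (h : 'rV[R]_n) : A a -> in_mv h ->
  exists2 b, A b & polymap f b = polymap f a + e ^+ 3 *: h.
Proof.
move=> [x mx <-] mh; have [F [fE F0 JF]] := normal_form.
have [mF Fsurj _] := normal_form_bijective F0 JF.
have [|y my Fy] := Fsurj (fun k => (F k).@[fun i => x 0 i] + (\adj M *m h^T) k 0).
  by move=> k; apply: R_local; [apply: mF | apply: in_m_mulmx => j; rewrite mxE].
exists (e ^+ 2 *: \row_i y i).
  by exists (\row_i y i) => // i; rewrite mxE.
rewrite !(polymap_scaled _ fE).
have -> : \col_k (F k).@[fun i => (\row_i y i) 0 i] =
    \col_k (F k).@[fun i => x 0 i] + \adj M *m h^T.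
  apply/colP => k; rewrite !mxE; rewrite [RHS](_ : _ = (F k).@[y]).
    by apply: meval_eq => i; rewrite mxE.
  by rewrite Fy !mxE.
rewrite mulmxDr mulmxA jac0_adj mul_scalar_mx linearD linearZ /= trmxK scalerDr.
by rewrite scalerA -exprSr.
Qed.

(** Applying adj M to e^2 M (F x - F y) = e c h and cancelling e gives
    e^2 (F x - F y) = c adj M h, and x - y is divisible by an entry of
    F x - F y. *)
Theorem scaled_inverse_lipschitz a b c (h : 'rV[R]_n) : A a -> A b ->
  in_mv h -> polymap f a - polymap f b = (e * c) *: h ->
  exists2 h', in_mv h' & a - b = c *: h'.
Proof.
move=> [x mx <-] [y my <-] mh; have [F [fE F0 JF]] := normal_form.
have [_ _ Fexp] := normal_form_bijective F0 JF.
rewrite !(polymap_scaled _ fE) -scalerBr -linearB -mulmxBr /=.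
set w := _ - _ => fxy.
have {}fxy : e ^+ 2 *: w = c *: (\adj M *m h^T).
  apply/colP => k; apply: (mulfI e_neq0).
  have : (\adj M *m (e ^+ 2 *: (M *m w)^T)^T) k 0 =
         (\adj M *m ((e * c) *: h)^T) k 0 by rewrite fxy.
  rewrite !linearZ /= trmxK mulmxA adj_jac0 mul_scalar_mx !mxE => H.
  by rewrite mulrCA H mulrA.
suff /choice[h' Hh'] i : exists h', max_ideal h' /\
    e ^+ 2 * (x 0 i - y 0 i) = c * h'.
  exists (\row_i h' i) => [i|]; first by rewrite mxE; have [] := Hh' i.
  apply/rowP => i; rewrite !mxE -mulrBr.
  by have [] := Hh' i.
have [j [k xyk]] := Fexp (fun i => x 0 i) (fun i => y 0 i) i mx my.
exists ((\adj M *m h^T) j 0 * k); split.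
  by rewrite mulrC; apply: max_ideal_mull; apply: in_m_mulmx => l; rewrite mxE.
rewrite xyk !mulrA; congr (_ * k).
have /colP/(_ j) := fxy.
by rewrite !mxE.
Qed.

End Normalization.

Lemma polymap_lipschitz (R : comUnitRingType) n (f : 'I_n -> {mpoly R[n]})
    (x h : 'rV[R]_n) c : is_local_ring R -> in_mv h ->
  exists2 h', in_mv h' & polymap f (x + c *: h) = polymap f x + c *: h'.
Proof.
move=> R_local mh.
pose K (a : R) := exists2 b, max_ideal b & a = c * b.
suff /choice[h' Hh'] j : exists b, max_ideal b /\
    (f j).@[fun i => (x + c *: h) 0 i] - (f j).@[fun i => x 0 i] = c * b.
  exists (\row_j h' j) => [j|]; first by rewrite mxE; have [] := Hh' j.
  apply/rowP => j; rewrite !mxE; have [_ <-] := Hh' j.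
  by rewrite addrC subrK.
suff [b mb ->] : K ((f j).@[fun i => (x + c *: h) 0 i] - (f j).@[fun i => x 0 i]).
  by exists b.
apply: meval_congr_ideal => [|a b [a' ma ->] [b' mb ->]|a b [b' mb ->]|i].
- by exists 0; rewrite ?mulr0 //; apply: max_ideal0.
- by exists (a' + b'); rewrite ?mulrDr //; apply: R_local.
- by exists (a * b'); rewrite 1?mulrCA //; apply: max_ideal_mull.
by exists (h 0 i); [apply: mh | rewrite !mxE; ring].
Qed.

(** * The valuation topology through divisibility *)

Section Valuation.
Variables (K : fieldType) (G : ordAbGroupType) (v : krullValuation K G).

Lemma kval1 : v 1 = 0.
Proof. by apply: (addrI (v 1)); rewrite -kvalM ?oner_eq0 // mulr1 addr0. Qed.

Lemma kvalV x : x != 0 -> v x^-1 = - v x.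
Proof.
move=> x0; apply: (addrI (v x)).
by rewrite -kvalM ?invr_eq0 // divff // kval1 subrr.
Qed.

Lemma ordab_leB0 (g h : G) : g <= h <-> 0 <= h - g.
Proof.
split=> [gh|gh]; first by have := ordab_leD2l (- g) gh; rewrite addNr addrC.
by have := ordab_leD2l g gh; rewrite addr0 addrC subrK.
Qed.

Lemma ordab_ltDl (g h : G) : g < g + h <-> 0 < h.
Proof.
rewrite !lt_neqAle; split=> /andP[gh].
  move/ordab_leB0; rewrite addrC addKr => ->; rewrite andbT.
  by apply: contra gh => /eqP <-; rewrite addr0.
move=> h0; apply/andP; split.
  by apply: contra gh => /eqP H; apply/eqP/(addrI g); rewrite addr0.
by apply/ordab_leB0; rewrite addrC addKr.
Qed.
End Valuation.

Section ValuationTopology.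
Variables (R : idomainType) (G : ordAbGroupType).
Variable v : krullValuation {fraction R} G.
Hypothesis v_ring : is_valuation_ring v.
Local Notation T := (valued_ring v).

Lemma valuation_divides_total (a b : R) : divides a b \/ divides b a.
Proof.
have [->|a0] := eqVneq a 0; first by right; apply: divides0.
have [->|b0] := eqVneq b 0; first by left; apply: divides0.
have le_divides (c d : R) : c != 0 -> d != 0 ->
    v (tofrac c) <= v (tofrac d) -> divides c d.
  move=> c0 d0 /ordab_leB0; rewrite addrC -kvalV ?tofrac_eq0 //.
  rewrite -kvalM ?invr_eq0 ?tofrac_eq0 // => cd.
  have [r rE] := proj2 (v_ring _) (or_intror cd).
  exists r; apply/eqP; rewrite -tofrac_eq tofracM -rE mulVKf // ?tofrac_eq0 //.
by case/orP: (ordab_total (v (tofrac a)) (v (tofrac b))) => /le_divides H;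
  [left|right]; apply: H.
Qed.

Lemma max_ideal_kval (h : R) : h != 0 -> max_ideal h <-> 0 < v (tofrac h).
Proof.
move=> h0; have h0' : tofrac h != 0 by rewrite tofrac_eq0.
have vh : 0 <= v (tofrac h).
  have [[]|//] := proj1 (v_ring (tofrac h)) (ex_intro _ h erefl).
  by move/eqP; rewrite (negbTE h0').
split=> [mh|].
  rewrite lt_neqAle vh andbT; apply/eqP => v0; move: mh; apply/max_idealPn.
  have [|r rE] := proj2 (v_ring (tofrac h)^-1).
    by right; rewrite kvalV // -v0 oppr0.
  apply/unitrP; exists r; suff rh : r * h = 1 by rewrite rh mulrC rh.
  by apply/eqP; rewrite -tofrac_eq tofracM -rE mulVf // tofrac1.
move=> vh0 /=; apply/negP => uh.
have hV : tofrac h^-1 = (tofrac h)^-1.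
  apply: (mulfI h0'); rewrite divff // -tofracM divrr // tofrac1 //.
have [[]|] := proj1 (v_ring (tofrac h^-1)) (ex_intro _ h^-1 erefl).
  by move/eqP; rewrite hV invr_eq0 (negbTE h0').
rewrite hV kvalV // => vN.
have := ordab_leD2l (v (tofrac h)) vN; rewrite subrr addr0.
by move/(lt_le_trans vh0); rewrite ltxx.
Qed.

Lemma vball_coset (c : R) (x y : T) : c != 0 ->
  vball v x (v (tofrac c)) y <-> exists2 h : T, max_ideal h & y = x + c * h.
Proof.
move=> c0; split=> [[->|vy]|[h mh ->]].
- by exists 0; [apply: max_ideal0 | rewrite mulr0 addr0].
- have [yx|yx0] := eqVneq (y - x) 0.
    exists 0; first exact: max_ideal0.
    by rewrite mulr0 addr0; apply/eqP; rewrite -subr_eq0 yx.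
  have [[h yxE]|[h cE]] := valuation_divides_total c (y - x).
    have h0 : h != 0 by apply: contraNneq yx0 => h0; rewrite yxE h0 mulr0.
    exists h; last by rewrite -yxE addrC subrK.
    apply/max_ideal_kval => //; move: vy; rewrite yxE tofracM.
    by rewrite kvalM ?tofrac_eq0 // => /ordab_ltDl.
  have h0 : h != 0 by apply: contraNneq c0 => h0; rewrite cE h0 mulr0.
  exfalso; move: vy; rewrite {1}cE tofracM kvalM ?tofrac_eq0 //.
  have vh : 0 <= v (tofrac h).
    have [[]|//] := proj1 (v_ring (tofrac h)) (ex_intro _ h erefl).
    by move/eqP; rewrite tofrac_eq0 (negbTE h0).
  have := ordab_leD2l (v (tofrac (y - x : R))) vh; rewrite addr0 => le1 lt1.
  by have := le_lt_trans le1 lt1; rewrite ltxx.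
have [->|h0] := eqVneq h 0; first by left; rewrite mulr0 addr0.
right; rewrite addrC addKr tofracM kvalM ?tofrac_eq0 //.
by apply/ordab_ltDl/max_ideal_kval.
Qed.

Hypothesis R_local : is_local_ring R.

(** Balls x + c m with c in R suffice: a ball of negative radius contains
    x + m, and a radius g >= 0 is the value of an element of R. *)
Lemma nbhs_valuedE (x : T) (V : set T) :
  nbhs x V <-> exists2 c : T, c != 0 & forall h, max_ideal h -> V (x + c * h).
Proof.
split.
  move=> [U [oU Ux UV]]; have [g gU] := oU x Ux.
  suff [c c0 gc] : exists2 c : R, c != 0 & g <= v (tofrac c).
    exists c => // h mh; apply/UV/gU.
    have [->|] : vball v x (v (tofrac c)) (x + c * h).
    - by apply/vball_coset => //; exists h.
    - by left.
    by move=> vy; right; apply: le_lt_trans gc vy.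
  have [y y0 yg] := kval_surj v g.
  case/orP: (ordab_total 0 g) => g0; last first.
    by exists 1; [apply: oner_neq0 | rewrite tofrac1 kval1].
  have [|c cE] := proj2 (v_ring y); first by right; rewrite yg.
  by exists c; [rewrite -tofrac_eq0 -cE | rewrite -cE yg].
move=> [c c0 cV]; exists (vball v x (v (tofrac (c : R)))); split.
- move=> y /(vball_coset _ _ c0)[h mh ->]; exists (v (tofrac (c : R))).
  move=> z /(vball_coset _ _ c0)[k mk ->]; apply/vball_coset => //.
  by exists (h + k); [apply: R_local | rewrite mulrDr addrA].
- by left.
by move=> y /(vball_coset _ _ c0)[h mh ->]; apply: cV.
Qed.

Lemma nbhs_rowE n (x : 'rV[T]_n) (V : set 'rV[T]_n) :
  nbhs x V <-> exists2 c : T, c != 0 & forall h, in_mv h -> V (x + c *: h).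
Proof.
split.
  move=> [P Px PV].
  have /choice[c Hc] j : exists c : T, c != 0 /\
      forall h, max_ideal h -> P 0 j (x 0 j + c * h).
    by have /nbhs_valuedE[c c0 cP] := Px 0 j; exists c.
  exists (\prod_j c j).
    by apply/prodf_neq0 => j _; have [] := Hc j.
  move=> h mh; apply: PV => i j; rewrite ord1 !mxE (bigD1 j) //= -mulrA.
  by have [_] := Hc j; apply; apply: max_ideal_mull.
move=> [c c0 cV].
exists (fun i j => [set y | exists2 h : T, max_ideal h & y = x i j + c * h]).
  by move=> i j; apply/nbhs_valuedE; exists c => // h mh; exists h.
move=> y yP; have /choice[h Hh] j : exists h : T, max_ideal h /\ y 0 j = x 0 j + c * h.
  by have [h mh yE] := yP 0 j; exists h.
have -> : y = x + c *: \row_j h j.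
  by apply/rowP => j; rewrite !mxE; have [_] := Hh j.
by apply: cV => j; rewrite mxE; have [] := Hh j.
Qed.
End ValuationTopology.

(** * The open embedding *)

Theorem proposition4 (R : idomainType) (G : ordAbGroupType)
    (v : krullValuation {fraction R} G)
    (v_ring : is_valuation_ring v) (R_hens : is_henselian R)
    (n : nat) (n_ge1 : (1 <= n)%N)
    (f : 'I_n -> {mpoly (valued_ring v)[n]}) (e : valued_ring v)
    (f0 : polymap f 0 = 0)
    (eE : e = (jacobian f).@[fun=> 0])
    (e_neq0 : e != 0) :
  open_embedding
    (scaled_max_ideal_power (n := n) (e ^+ 2))
    (scaled_max_ideal_power (n := n) e)
    (polymap f).
Proof.
have R_local := proj1 R_hens.
have T_hens : is_henselian (valued_ring v) by [].
have T_total : forall a b : valued_ring v, divides a b \/ divides b a.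
  exact: (valuation_divides_total v_ring).
have f0' j : (f j).@[fun=> 0] = 0.
  have /rowP/(_ j) := f0; rewrite !mxE => fj0; rewrite -[RHS]fj0.
  by apply: meval_eq => i; rewrite mxE.
have sub := scaled_image_sub T_hens T_total f0' eE.
have opn := scaled_image_open T_hens T_total f0' eE.
have lip := scaled_inverse_lipschitz T_hens T_total f0' eE e_neq0.
set A := scaled_max_ideal_power (e ^+ 2) in sub opn lip *.
have injf a b : A a -> A b -> polymap f a = polymap f b -> a = b.
  move=> Aa Ab ab; have [||h _] := lip a b 0 0 Aa Ab.
  - by move=> j; rewrite mxE; apply: max_ideal0.
  - by rewrite ab subrr scaler0.
  by rewrite scale0r => /eqP; rewrite subr_eq0 => /eqP.
split.
- by move=> _ [a Aa <-]; apply: sub.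
- exists (polymap f @` A); last first.
    by rewrite setIidl // => _ [a Aa <-]; apply: sub.
  rewrite openE => _ [a Aa <-]; apply/(nbhs_rowE v_ring R_local).
  exists (e ^+ 3); first exact: expf_neq0.
  by move=> h mh; have [b Ab <-] := opn a h Aa mh; exists b.
- apply: continuous_subspaceT => x V /(nbhs_rowE v_ring R_local)[c c0 cV].
  apply/(nbhs_rowE v_ring R_local); exists c => // h mh.
  by have [h' mh' /= ->] := polymap_lipschitz f x c R_local mh; apply: cV.
have [g gK] : exists g : 'rV[valued_ring v]_n -> 'rV[valued_ring v]_n,
    forall a, A a -> g (polymap f a) = a.
  have /choice[g Hg] y : exists a, (exists2 b, A b & polymap f b = y) ->
      A a /\ polymap f a = y.
    have [[b Ab by_]|nb] := EM (exists2 b, A b & polymap f b = y).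
      by exists b.
    by exists 0.
  exists g => a Aa; have [Ag fg] := Hg _ (ex_intro2 _ _ a Aa erefl).
  exact: injf.
exists g; split; first by move=> a; rewrite inE; apply: gK.
apply/subspace_continuousP => _ [a Aa <-] V.
rewrite /from_subspace gK // => /(nbhs_rowE v_ring R_local)[c c0 cV].
apply/(nbhs_rowE v_ring R_local); exists (e * c); first by rewrite mulf_neq0.
move=> h mh /= [b Ab fb]; rewrite -fb gK //.
have [h' mh' baE] : exists2 h', in_mv h' & b - a = c *: h'.
  by apply: (lip b a c h) => //; rewrite fb addrC addKr.
by rewrite -[b](subrK a) addrC baE; apply: cV.
Qed.
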